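(* Let $(g_i)_{i=1}^\infty$ be a Bessel sequence in $\mathcal{H}$ and let $(f_i)_{i=1}^\infty$ be a sequence in $\mathcal{H}$ satisfying $$f=\sum_{i=1}^\infty\langle f,g_i\rangle f_i,\quad\forall f\in\mathcal{H}.$$ Then $g=\sum_{i=1}^\infty\langle g,f_i\rangle g_i$ for every $g\in\mathcal{H}$ such that $(\langle g,f_i\rangle)_{i=1}^\infty\in\ell^2$. The set $\mathcal{D}=\{g\in\mathcal{H}:(\langle g,f_i\rangle)_{i=1}^\infty\in\ell^2\}$ is optimal in the sense that a general statement for a larger subset of $\mathcal{H}$ cannot be claimed: there exist a Bessel sequence $(g_i)_{i=1}^\infty$ in $\mathcal{H}$ and a sequence $(f_i)_{i=1}^\infty$ in $\mathcal{H}$ satisfying $f=\sum_{i=1}^\infty\langle f,g_i\rangle f_i$ for all $f\in\mathcal{H}$, with $\mathcal{D}\ne\mathcal{H}$, for which $g=\sum_{i=1}^\infty\langle g,f_i\rangle g_i$ holds if and only if $g\in\mathcal{D}$.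
   Context: $\mathcal{H}$ is an infinite-dimensional separable Hilbert space. All series converge in norm. A sequence $(g_i)_{i=1}^\infty$ in $\mathcal{H}$ is a Bessel sequence if there is $B>0$ with $\sum_{i=1}^\infty|\langle h,g_i\rangle|^2\le B\|h\|^2$ for all $h\in\mathcal{H}$. *)

(* Defs.v *)
From HB Require Import structures.
From mathcomp Require Import all_boot all_order all_algebra.
From mathcomp Require Import complex.
From mathcomp Require Import all_classical all_reals all_analysis.
Import Order.TTheory GRing.Theory Num.Theory.
Import numFieldNormedType.Exports.

Set Implicit Arguments.
Unset Strict Implicit.
Unset Printing Implicit Defensive.

Local Open Scope classical_set_scope.
Local Open Scope ring_scope.

(* Hilbert spaces are taken over the real or the complex numbers. *)
Variant scalars := RealScalars | ComplexScalars.

Definition scalar_field (R : realType) (s : scalars) : numFieldType :=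
  match s with
  | RealScalars => R
  | ComplexScalars => complex R
  end.

Definition scalar_conj (R : realType) (s : scalars) :
    scalar_field R s -> scalar_field R s :=
  match s with
  | RealScalars => idfun
  | ComplexScalars => @conjc R
  end.

(* A Hilbert space is a complete normed module together with a positive
   definite hermitian form, linear in its first argument and conjugate-linear
   in the second, that induces the norm. *)
Definition induces_norm (K : numFieldType) (H : normedModType K)
    (dot : H -> H -> K) : Prop :=
  forall x, `|x| ^+ 2 = dot x x.

Definition infinite_dimensional (K : numFieldType) (H : lmodType K) : Prop :=
  ~ exists (n : nat) (v : 'I_n -> H),
      forall x : H, exists c : 'I_n -> K, x = \sum_(i < n) c i *: v i.

Definition separable (T : topologicalType) : Prop :=
  exists2 A : set T, countable A & dense A.

(* The norm of K takes its values in K: over the complex numbers, the series of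
   squared moduli are series of nonnegative real elements of K, and x <= y
   means that y - x is real and nonnegative. *)
Definition square_summable (K : numFieldType) (c : nat -> K) : Prop :=
  cvgn (series (fun i => `|c i| ^+ 2)).

Definition bessel_sequence (K : numFieldType) (H : normedModType K)
    (dot : H -> H -> K) (g : nat -> H) : Prop :=
  exists2 B : K, 0 < B & forall h : H,
    square_summable (fun i => dot h (g i)) /\
    limn (series (fun i => `|dot h (g i)| ^+ 2)) <= B * `|h| ^+ 2.

Definition l2_domain (K : numFieldType) (H : normedModType K)
    (dot : H -> H -> K) (f : nat -> H) : set H :=
  [set x | square_summable (fun i => dot x (f i))].

(* Main.v *)
Require Import Defs.
From mathcomp Require Import all_boot all_order all_algebra.
From mathcomp Require Import complex ring.
From mathcomp Require Import all_classical all_reals all_analysis.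
Import Order.TTheory GRing.Theory Num.Theory.
Import numFieldNormedType.Exports.

(** Reconstruction with the roles of the two sequences exchanged is a matter of
    duality.  If the g_i form a Bessel sequence with bound B, then
    |sum c_i g_i|^2 <= B sum |c_i|^2 for finite sums, so that sum c_i g_i
    converges for every square-summable c ([bessel_synthesis_cvg]).  When
    c_i = <y, f_i>, pairing the sum with any x gives
    sum <x, g_i> <f_i, y> = <x, y>, by continuity of the inner product and the
    assumed expansion of x; hence the sum is y ([dual_reconstruction]).

    For optimality, Gram-Schmidt applied to a dense sequence, with vanishing
    residuals normalized to 0 instead of being discarded, yields a sequence
    (e_n) with x = sum <x, e_n> e_n and |x|^2 = sum |<x, e_n>|^2, infinitely
    many of whose members are unit vectors ([parseval_frame_exists]).  Fix a
    nonzero vector h, for example one of the e_n, and interleave: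
      g = e_0, e_0, e_1, e_1, ...      f = e_0 + h, -h, e_1 + h, -h, ...
    In sum <x, g_i> f_i the contributions of h cancel in pairs, and they are
    small because <x, e_n> tends to 0; so the expansion holds.  On the dual
    side the constant coefficient <y, h> is neither square-summable nor, when
    multiplied by the unit vectors among the e_n, the coefficient of terms
    tending to 0, unless it vanishes.  Hence the domain of f and the set where
    the dual expansion converges are both the hyperplane orthogonal to h
    ([shifted_l2_domainP], [dual_cvg_orth]).

    Both scalar fields are handled at once by working over a numeric field with
    a map theta such that |theta a| = |a| and a * theta a = |a|^2. *)

Set Implicit Arguments.
Unset Strict Implicit.
Unset Printing Implicit Defensive.

Local Open Scope classical_set_scope.
Local Open Scope ring_scope.

(** * Sequences and series over a numeric field *)

(** The field may be only partially ordered, as the complex numbers are; the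
    nonnegative elements are still closed, being those fixed by the norm. *)
Lemma numfield_nondecreasing_cvg_le (K : numFieldType) (u : nat -> K) (l : K) :
  (forall m n, (m <= n)%N -> u m <= u n) -> u @ \oo --> l ->
  forall n, u n <= l.
Proof.
move=> u_nd ul n; rewrite -subr_ge0 -[_ - _]/(l - u n).
have lim1 : (fun k => u k - u n) @ \oo --> l - u n.
  by apply: cvgB => //; exact: cvg_cst.
have lim2 : (fun k => u k - u n) @ \oo --> `|l - u n|.
  apply: cvg_trans (cvg_norm lim1); apply: near_eq_cvg.
  near=> k; rewrite ger0_norm// subr_ge0; apply: u_nd.
  by near: k; exact: nbhs_infty_ge.
by rewrite (cvg_unique (@norm_hausdorff _ _) lim1 lim2).
Unshelve. all: by end_near. Qed.

Lemma cvg_norm2_0 (K : numFieldType) (a : nat -> K) :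
  (fun n => `|a n| ^+ 2) @ \oo --> (0 : K) -> a @ \oo --> (0 : K).
Proof.
move=> /cvgr0Pnorm_lt a0; apply/cvgr0Pnorm_lt => eps eps0.
have /a0 : 0 < eps ^+ 2 by rewrite exprn_gt0.
apply: filterS => n; rewrite ger0_norm ?exprn_ge0// ltr_pXn2r ?nnegrE//.
exact: ltW.
Qed.

Lemma cvg_even_odd (T : topologicalType) (u : nat -> T) (l : T) :
  (fun n => u n.*2) @ \oo --> l -> (fun n => u n.*2.+1) @ \oo --> l ->
  u @ \oo --> l.
Proof.
move=> ev od A Al.
have [M _ evM] := ev A Al; have [N _ odN] := od A Al.
exists (maxn M N).*2 => // n /= leMNn; rewrite -(odd_double_half n).
have : (maxn M N <= n./2)%N by rewrite -(doubleK (maxn M N)) half_leq.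
rewrite geq_max => /andP[leM leN]; case: (odd n); first exact: odN.
exact: evM.
Qed.

Lemma series_double (V : zmodType) (u : nat -> V) n :
  series u n.*2 = series (fun i => u i.*2 + u i.*2.+1) n.
Proof.
elim: n => [|n IHn]; first by rewrite /series /= !big_geq.
by rewrite doubleS !seriesSr IHn addrA.
Qed.

(** Grouping consecutive terms is harmless as soon as the first term of each
    pair tends to 0, since it is what separates odd from even partial sums. *)
Lemma cvg_series_pairs (K : numFieldType) (V : normedModType K)
    (u : nat -> V) (l : V) :
  series (fun i => u i.*2 + u i.*2.+1) @ \oo --> l ->
  (fun i => u i.*2) @ \oo --> (0 : V) ->
  series u @ \oo --> l.
Proof.
move=> pairs ev0; have evl : (fun n => series u n.*2) @ \oo --> l.
  by under eq_fun do rewrite series_double.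
apply: cvg_even_odd => //; under eq_fun do rewrite seriesSr.
by rewrite -[l]addr0; exact: cvgD.
Qed.

(** * Inner product spaces *)

Section InnerProduct.
Variables (K : numFieldType) (theta : K -> K).
Hypothesis theta_norm : forall a, `|theta a| = `|a|.
Hypothesis mul_theta : forall a, a * theta a = `|a| ^+ 2.
Variables (H : normedModType K) (dot : {dot H for theta}).
Hypothesis dot_norm : induces_norm dot.

Lemma dotC x y : dot x y = theta (dot y x).
Proof. by rewrite [LHS]hermitian_subproof expr0 mul1r. Qed.

Lemma norm_dotC x y : `|dot x y| = `|dot y x|.
Proof. by rewrite dotC theta_norm. Qed.

Lemma dotC_eq0 x y : dot x y = 0 -> dot y x = 0.
Proof. by move=> xy0; apply/eqP; rewrite -normr_eq0 norm_dotC xy0 normr0. Qed.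

Lemma dot_eq0 x : dot x x = 0 -> x = 0.
Proof.
by rewrite -dot_norm => /eqP; rewrite expf_eq0/= normr_eq0 => /eqP.
Qed.

Lemma dotZr a x y : dot x (a *: y) = theta a * dot x y.
Proof. exact: linearZr_LR. Qed.

Lemma dotZl a x y : dot (a *: x) y = a * dot x y.
Proof. exact: linearZl_LR. Qed.

Lemma norm2_add_orth x y : dot x y = 0 ->
  `|x + y| ^+ 2 = `|x| ^+ 2 + `|y| ^+ 2.
Proof.
move=> xy0; rewrite !dot_norm linearDl !linearDr/= xy0 (dotC_eq0 xy0).
by rewrite addr0 add0r.
Qed.

(** The usual proof: the vector <y, y> x - <x, y> y is, up to a factor, the
    component of x orthogonal to y, and its squared norm is nonnegative. *)
Lemma CauchySchwarz_norm x y : `|dot x y| <= `|x| * `|y|.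
Proof.
have [->|y0] := eqVneq y 0; first by rewrite linear0r normr0 normr0 mulr0.
rewrite -(@ler_pXn2r _ 2)// ?nnegrE ?mulr_ge0// exprMn.
have yy_gt0 : 0 < `|y| ^+ 2 by rewrite exprn_gt0// normr_gt0.
have yyE : theta (`|y| ^+ 2) = `|y| ^+ 2 by rewrite dot_norm -dotC.
pose z := dot y y *: x - dot x y *: y.
have : 0 <= dot z z by rewrite -dot_norm exprn_ge0.
have -> : dot z z = `|y| ^+ 2 * (`|x| ^+ 2 * `|y| ^+ 2 - `|dot x y| ^+ 2).
  rewrite /z linearBl !linearBr/= !dotZl !dotZr -!dot_norm yyE (dotC y x).
  by rewrite -mul_theta; ring.
by rewrite pmulr_rge0// subr_ge0.
Qed.

Lemma cvg_dotl (u : nat -> H) (l y : H) :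
  u @ \oo --> l -> (fun n => dot (u n) y) @ \oo --> dot l y.
Proof.
move=> /cvgrPdist_lt ul; apply/cvgrPdist_lt => eps eps0.
have y1 : 0 < `|y| + 1 by rewrite ltr_wpDl.
have /ul : 0 < eps / (`|y| + 1) by rewrite divr_gt0.
apply: filterS => n; rewrite ltr_pdivlMr// => lt_eps.
rewrite -linearBl; apply: le_lt_trans lt_eps.
by rewrite (le_trans (CauchySchwarz_norm _ _))// ler_wpM2l// lerDl.
Qed.

Lemma cvg_dotr (u : nat -> H) (l x : H) :
  u @ \oo --> l -> (fun n => dot x (u n)) @ \oo --> dot x l.
Proof.
move=> ul; apply/cvgrPdist_lt => eps eps0.
have /cvgrPdist_lt/(_ eps eps0) := cvg_dotl (y := x) ul.
by apply: filterS => n; rewrite -!linearBl -linearBr norm_dotC.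
Qed.

(** * Synthesis with a Bessel sequence *)

(** The analysis bound passes to arbitrary finite stretches of indices because
    the partial sums increase to the limit. *)
Lemma bessel_partial_sum (g : nat -> H) : bessel_sequence dot g ->
  exists2 B : K, 0 < B & forall h m n,
    \sum_(m <= i < n) `|dot h (g i)| ^+ 2 <= B * `|h| ^+ 2.
Proof.
move=> [B B0 besselB]; exists B => // h m n.
have [sq leB] := besselB h; apply: le_trans leB.
have nd a b : (a <= b)%N -> series (fun i => `|dot h (g i)| ^+ 2) a
                         <= series (fun i => `|dot h (g i)| ^+ 2) b.
  move=> ab; rewrite -subr_ge0 sub_series_geq//.
  by apply: sumr_ge0 => i _; rewrite exprn_ge0.
apply: le_trans (numfield_nondecreasing_cvg_le nd sq n).
have ge0 k : 0 <= series (fun i => `|dot h (g i)| ^+ 2) k.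
  by apply: sumr_ge0 => i _; rewrite exprn_ge0.
have [mn|/ltnW nm] := leqP m n; last by rewrite big_geq.
by rewrite -sub_series_geq// gerBl.
Qed.

(** Synthesis is the adjoint of analysis, hence has the same bound.  Writing v
    for the sum, |v|^2 <= sum |c_i| |<v, g_i>|; the arithmetic-geometric mean
    inequality, weighted by B, bounds 2B|v|^2 by
    B^2 sum |c_i|^2 + sum |<v, g_i>|^2, whose last term is at most B|v|^2 and
    can be absorbed on the left. *)
Lemma bessel_synthesis_bound (g : nat -> H) (B : K) (c : nat -> K) m n :
  0 < B ->
  (forall h, \sum_(m <= i < n) `|dot h (g i)| ^+ 2 <= B * `|h| ^+ 2) ->
  `|\sum_(m <= i < n) c i *: g i| ^+ 2 <= B * \sum_(m <= i < n) `|c i| ^+ 2.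
Proof.
move=> B0 besselB; set v := \sum_(m <= i < n) _; set C := \sum_(m <= i < n) _.
have vE : `|v| ^+ 2 <= \sum_(m <= i < n) `|c i| * `|dot v (g i)|.
  rewrite -[leLHS]ger0_norm ?exprn_ge0// dot_norm {1}/v linear_sumlz.
  apply: le_trans (ler_norm_sum _ _ _) _; apply: ler_sum => i _.
  by rewrite /= dotZl normrM norm_dotC.
have amgm : B * `|v| ^+ 2 *+ 2 <= B ^+ 2 * C + \sum_(m <= i < n) `|dot v (g i)| ^+ 2.
  rewrite /C mulr_sumr -big_split/=.
  apply: (@le_trans _ _ (B * (\sum_(m <= i < n) `|c i| * `|dot v (g i)|) *+ 2)).
    by rewrite lerMn2r/= ler_pM2l.
  rewrite mulr_sumr -sumrMnl; apply: ler_sum => i _; rewrite mulrA -exprMn.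
  by rewrite real_leif_mean_square_scaled ?realM// ?gtr0_real// normr_real.
rewrite -(@ler_pM2l _ B)// [leRHS]mulrA -expr2 -(lerD2r (B * `|v| ^+ 2)) -mulr2n.
by apply: le_trans amgm _; rewrite lerD2l.
Qed.

End InnerProduct.

Section Duality.
Variables (K : numFieldType) (theta : K -> K).
Hypothesis theta_norm : forall a, `|theta a| = `|a|.
Hypothesis mul_theta : forall a, a * theta a = `|a| ^+ 2.
Variables (H : completeNormedModType K) (dot : {dot H for theta}).
Hypothesis dot_norm : induces_norm dot.

Lemma bessel_synthesis_cvg (g : nat -> H) (c : nat -> K) :
  bessel_sequence dot g -> square_summable c ->
  cvgn (series (fun i => c i *: g i)).
Proof.
move=> /bessel_partial_sum[B B0 besselB] /cvg_cauchy/cauchy_seriesP csq.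
apply: cauchy_cvg; apply/cauchy_seriesP => eps eps0.
have /csq : 0 < eps ^+ 2 / B by rewrite divr_gt0// exprn_gt0.
apply: filterS => -[m n] /=; rewrite ger0_norm; last first.
  by apply: sumr_ge0 => i _; rewrite exprn_ge0.
rewrite ltr_pdivlMr// mulrC => lt_eps.
rewrite -(@ltr_pXn2r _ 2)// ?nnegrE ?(ltW eps0)//.
apply: le_lt_trans lt_eps.
by apply: (bessel_synthesis_bound theta_norm dot_norm).
Qed.

(** The limit and y have the same inner product with every x: one side expands
    the series of the dual, the other the given expansion of x, and the partial
    sums agree term by term. *)
Theorem dual_reconstruction (g f : nat -> H) :
  bessel_sequence dot g ->
  (forall x : H, series (fun i => dot x (g i) *: f i) @ \oo --> x) ->
  forall y : H, square_summable (fun i => dot y (f i)) ->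
    series (fun i => dot y (f i) *: g i) @ \oo --> y.
Proof.
move=> bg rec y ysq; have := bessel_synthesis_cvg bg ysq.
set u := series _ => cu; suff <- : limn u = y by [].
apply/eqP; rewrite -subr_eq0; apply/eqP.
apply: (dot_eq0 dot_norm); set x := limn u - y.
have lim1 := cvg_dotr theta_norm mul_theta dot_norm (x := x) cu.
have lim2 := cvg_dotl mul_theta dot_norm (y := y) (rec x).
rewrite {2}/x linearBr/=; apply/eqP; rewrite subr_eq0; apply/eqP.
apply: cvg_unique lim1 _; first exact: norm_hausdorff.
apply: cvg_trans lim2; apply: near_eq_cvg; near=> n.
rewrite /u /series/= linear_sumr linear_sumlz.
by apply: eq_bigr => i _; rewrite /= dotZl dotZr -dotC mulrC.
Unshelve. all: by end_near. Qed.
End Duality.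

(** * Gram-Schmidt orthonormalization *)

Lemma separable_dense_sequence (T : ptopologicalType) : separable T ->
  exists d : nat -> T, dense (range d).
Proof.
move=> [A cA denA]; have [A0|[d]] := elimT pfcard_geP cA.
  by case: (@dense0 T); rewrite -A0.
exists d => O O0 /(denA O O0)[x [Ox /(surj (f := d))[n _ dnx]]].
by exists x; split => //; exists n.
Qed.

Section GramSchmidt.
Variables (K : numFieldType) (theta : K -> K).
Hypothesis theta_norm : forall a, `|theta a| = `|a|.
Hypothesis mul_theta : forall a, a * theta a = `|a| ^+ 2.
Variables (H : normedModType K) (dot : {dot H for theta}).
Hypothesis dot_norm : induces_norm dot.
Variable d : nat -> H.

Definition normalize (x : H) : H := `|x|^-1 *: x.

(** The recursion carries the orthogonal projection onto the span of the first
    n vectors; the next vector is the normalized residual of d n.  A residual 0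
    is normalized to 0 since 0^-1 = 0, so that no reindexing is needed. *)
Fixpoint gs_proj (n : nat) : H -> H :=
  if n is m.+1 then
    fun x => let e := normalize (d m - gs_proj m (d m)) in
             gs_proj m x + dot x e *: e
  else fun=> 0.

Definition gs (n : nat) : H := normalize (d n - gs_proj n (d n)).

Lemma gs_projE n x : gs_proj n x = series (fun i => dot x (gs i) *: gs i) n.
Proof.
elim: n => [|n IHn]; first by rewrite /series/= big_geq.
by rewrite seriesSr -IHn.
Qed.

Lemma gs_projB n x y : gs_proj n (x - y) = gs_proj n x - gs_proj n y.
Proof.
rewrite !gs_projE /series/= -sumrB; apply: eq_bigr => i _.
by rewrite linearBl/= scalerBl.
Qed.

Lemma norm_gs n : gs n != 0 -> `|gs n| = 1.
Proof.
move=> gs0; rewrite /gs normfZV//; apply: contraNneq gs0 => r0.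
by rewrite /gs r0 /normalize scaler0.
Qed.

Lemma dot_gs_gs x n : dot x (gs n) * dot (gs n) (gs n) = dot x (gs n).
Proof.
have [->|/norm_gs e1] := eqVneq (gs n) 0; first by rewrite linear0r mul0r.
by rewrite -(dot_norm (gs n)) e1 expr1n mulr1.
Qed.

(** Orthogonality of the system is the instance x = d n, up to a scalar; it is
    obtained inside the induction, where it gives the next step. *)
Lemma gs_residual_orth n i x : (i < n)%N -> dot (x - gs_proj n x) (gs i) = 0.
Proof.
elim: n i x => // n IHn i x.
have orth_n j : (j < n)%N -> dot (gs n) (gs j) = 0.
  by move=> jn; rewrite [gs n]/gs /normalize (dotZl dot) IHn// mulr0.
rewrite /= -/(gs n) opprD addrA linearBl/= (dotZl dot).
rewrite ltnS leq_eqVlt => /predU1P[->|lt_in]; last first.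
  by rewrite IHn// orth_n// mulr0 subrr.
rewrite dot_gs_gs linearBl/= gs_projE linear_sumlz/= big_nat big1 ?subr0 ?subrr//.
move=> j /andP[_ jn]; rewrite (dotZl dot).
by rewrite (dotC_eq0 theta_norm (orth_n j jn)) mulr0.
Qed.

Lemma gs_residual_orth_proj n x y : dot (x - gs_proj n x) (gs_proj n y) = 0.
Proof.
rewrite [gs_proj n y]gs_projE linear_sumr/= big_nat big1// => i /andP[_ lt_in].
by rewrite (dotZr dot) gs_residual_orth// mulr0.
Qed.

Lemma norm2_gs_proj n x :
  `|gs_proj n x| ^+ 2 = series (fun i => `|dot x (gs i)| ^+ 2) n.
Proof.
have := gs_residual_orth_proj n x x.
rewrite linearBl/= -dot_norm => /eqP; rewrite subr_eq0 => /eqP <-.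
rewrite gs_projE linear_sumr/=; apply: eq_bigr => i _.
by rewrite (dotZr dot) mulrC mul_theta.
Qed.

Lemma norm_gs_residual_le n x : `|x - gs_proj n x| <= `|x|.
Proof.
rewrite -(@ler_pXn2r _ 2)// ?nnegrE// -{3}(subrK (gs_proj n x) x).
have orth := gs_residual_orth_proj n x x.
by rewrite (norm2_add_orth theta_norm dot_norm orth) lerDl exprn_ge0.
Qed.

Lemma dot_gs_proj_gs n x : dot (gs_proj n x) (gs n) = 0.
Proof.
apply: (dotC_eq0 theta_norm); rewrite [gs n]/gs /normalize (dotZl dot).
by rewrite gs_residual_orth_proj mulr0.
Qed.

(** For n = m + 1, the residual of d m is a multiple of gs m, and also orthogonal
    to it.  For larger n the added component vanishes, d m being already fixed
    by the previous projection. *)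
Lemma gs_proj_id m n : (m < n)%N -> gs_proj n (d m) = d m.
Proof.
elim: n => // n IHn; rewrite ltnS leq_eqVlt => /predU1P[->|lt_mn]; last first.
  rewrite /= -/(gs n) IHn// -[X in dot X](IHn lt_mn).
  by rewrite dot_gs_proj_gs scale0r addr0.
pose r := d n - gs_proj n (d n).
have rE : r = `|r| *: gs n.
  have [r0|r0] := eqVneq r 0; first by rewrite r0 normr0 scale0r.
  by rewrite /gs /normalize scalerA divff ?normr_eq0// scale1r.
apply/esym/eqP; rewrite -subr_eq0; apply/eqP/(dot_eq0 dot_norm).
have {2}-> : d n - gs_proj n.+1 (d n) = (`|r| - dot (d n) (gs n)) *: gs n.
  by rewrite scalerBl -rE /= -/(gs n) opprD addrA.
by rewrite (dotZr dot) gs_residual_orth// mulr0.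
Qed.

(** If d m is within eps of x, then for n > m the residual of x is that of
    x - d m, which is no longer than x - d m. *)
Lemma gs_expansion : dense (range d) ->
  forall x, series (fun i => dot x (gs i) *: gs i) @ \oo --> x.
Proof.
move=> d_dense x; apply/cvgrPdist_lt => eps eps0.
have [z [xz [m _ dmz]]] : ball x eps `&` range d !=set0.
  apply: d_dense; last exact: ball_open.
  by exists x; exact: ballxx.
move: xz; rewrite -{z}dmz -ball_normE/= => xd.
near=> n; rewrite -gs_projE.
have -> : x - gs_proj n x = (x - d m) - gs_proj n (x - d m).
  rewrite gs_projB gs_proj_id; first by rewrite opprB addrA subrK.
  by near: n; exact: nbhs_infty_gt.
exact: le_lt_trans (norm_gs_residual_le _ _) xd.
Unshelve. all: by end_near. Qed.

(** Otherwise the expansions would be finite sums over a fixed range, and the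
    space would be spanned by finitely many vectors. *)
Lemma gs_neq0_infinitely_often : dense (range d) -> infinite_dimensional H ->
  forall N, exists2 n, (N <= n)%N & gs n != 0.
Proof.
move=> d_dense Hdim N; apply: contrapT => noN; apply: Hdim.
have gs0 n : (N <= n)%N -> gs n = 0.
  by move=> Nn; apply/eqP; apply: contrapT => /negP nz; apply: noN; exists n.
exists N, (fun i => gs i) => x; exists (fun i => dot x (gs i)).
apply: (cvg_unique (@norm_hausdorff _ _) (gs_expansion d_dense (x := x))).
apply: cvg_near_cst; near=> n; apply/eqP.
have Nn : (N <= n)%N by near: n; exact: nbhs_infty_ge.
rewrite /series/= (big_cat_nat _ Nn)//= big_mkord [X in _ + X]big_nat.
by rewrite [X in _ + X]big1 ?addr0// => i /andP[/gs0-> _]; rewrite scaler0.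
Unshelve. all: by end_near. Qed.

End GramSchmidt.

Lemma parseval_frame_exists (K : numFieldType) (theta : K -> K)
    (theta_norm : forall a, `|theta a| = `|a|)
    (mul_theta : forall a, a * theta a = `|a| ^+ 2)
    (H : normedModType K) (dot : {dot H for theta}) :
  induces_norm dot -> infinite_dimensional H -> separable H ->
  exists e : nat -> H,
    [/\ forall x, series (fun i => dot x (e i) *: e i) @ \oo --> x,
        forall x, series (fun i => `|dot x (e i)| ^+ 2) @ \oo --> `|x| ^+ 2
      & forall N, exists2 n, (N <= n)%N & `|e n| = 1].
Proof.
move=> dot_norm Hdim /separable_dense_sequence[d d_dense].
have expansion := gs_expansion theta_norm dot_norm d_dense.
exists (gs dot d); split => // [x|N]; last first.
  have [n Nn en] := gs_neq0_infinitely_often theta_norm dot_norm d_dense Hdim N.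
  by exists n => //; exact: norm_gs.
set s := series _; pose p := series (fun i => dot x (gs dot d i) *: gs dot d i).
have -> : s = (fun n => `|p n| * `|p n|).
  apply/funext => n; rewrite -expr2 /p -gs_projE.
  by rewrite (norm2_gs_proj theta_norm mul_theta dot_norm).
by rewrite expr2; apply: cvgM; apply: cvg_norm; exact: expansion.
Qed.

(** * A reconstruction that fails off its domain *)

Section Counterexample.
Variables (K : numFieldType) (theta : K -> K).
Hypothesis theta_norm : forall a, `|theta a| = `|a|.
Hypothesis mul_theta : forall a, a * theta a = `|a| ^+ 2.
Variables (H : completeNormedModType K) (dot : {dot H for theta}).
Hypothesis dot_norm : induces_norm dot.
Variables (e : nat -> H) (h : H).
Hypothesis expansion :
  forall x, series (fun i => dot x (e i) *: e i) @ \oo --> x.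
Hypothesis parseval :
  forall x, series (fun i => `|dot x (e i)| ^+ 2) @ \oo --> `|x| ^+ 2.
Hypothesis unit_infinitely_often :
  forall N, exists2 n, (N <= n)%N & `|e n| = 1.

(** With [doubled] as g and [shifted] as f, the pairs at 2n and 2n + 1 read
    (e n, e n) and (e n + h, - h): the vector h is inserted and removed. *)
Definition doubled (i : nat) : H := e i./2.

Definition shifted (i : nat) : H := if odd i then - h else e i./2 + h.

Lemma doubled_even i : doubled i.*2 = e i.
Proof. by rewrite /doubled doubleK. Qed.

Lemma doubled_odd i : doubled i.*2.+1 = e i.
Proof. by rewrite /doubled /= uphalf_double. Qed.

Lemma shifted_even i : shifted i.*2 = e i + h.
Proof. by rewrite /shifted odd_double doubleK. Qed.

Lemma shifted_odd i : shifted i.*2.+1 = - h.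
Proof. by rewrite /shifted /= odd_double. Qed.

Lemma coef2_cvg0 x : (fun i => `|dot x (e i)| ^+ 2) @ \oo --> (0 : K).
Proof.
apply: (@cvg_series_cvg_0 K K); apply/cvg_ex; exists (`|x| ^+ 2).
exact: parseval.
Qed.

Lemma coef_cvg0 x : (fun i => dot x (e i)) @ \oo --> (0 : K).
Proof. by apply: cvg_norm2_0; exact: coef2_cvg0. Qed.

Lemma doubled_bessel : bessel_sequence dot doubled.
Proof.
exists 2 => // x.
have cvg2 : series (fun i => `|dot x (doubled i)| ^+ 2) @ \oo --> 2 * `|x| ^+ 2.
  apply: (@cvg_series_pairs K K); last first.
    by under eq_fun do rewrite doubled_even; exact: coef2_cvg0.
  under [X in series X]eq_fun do rewrite doubled_even doubled_odd.
  rewrite seriesD mulr_natl mulr2n.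
  by apply: cvgD; exact: parseval.
split; first by apply/cvg_ex; exists (2 * `|x| ^+ 2).
by rewrite (cvg_lim (@norm_hausdorff _ _) cvg2).
Qed.

Lemma shifted_reconstruction x :
  series (fun i => dot x (doubled i) *: shifted i) @ \oo --> x.
Proof.
apply: cvg_series_pairs.
  under [X in series X]eq_fun do
    rewrite doubled_even doubled_odd shifted_even shifted_odd -scalerDr addrK.
  exact: expansion.
under eq_fun do rewrite doubled_even shifted_even scalerDr.
rewrite -[0]addr0; apply: cvgD.
  by apply: cvg_series_cvg_0; apply/cvg_ex; exists x; exact: expansion.
by rewrite -(scale0r h); apply: cvgZr_tmp; exact: coef_cvg0.
Qed.

(** Every odd-indexed coefficient of y is - <y, h>, so square summability forces
    it to be 0; the even-indexed ones are then the <y, e_i>. *)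
Lemma shifted_l2_domainP y : l2_domain dot shifted y <-> dot y h = 0.
Proof.
split=> [/cvg_series_cvg_0|yh0].
  under eq_fun do rewrite expr2.
  move=> /cvgr0Pnorm_lt lt_eps; apply/eqP/negPn/negP => c0.
  have /lt_eps[N _ /(_ N.*2.+1)] : 0 < `|dot y h| ^+ 2 by rewrite exprn_gt0 ?normr_gt0.
  rewrite /= shifted_odd linearNr/= normrN normrM !normr_id -expr2 ltxx.
  by move=> /(_ _)/notF; apply; rewrite ltnW// ltnS -addnn leq_addr.
apply/cvg_ex; exists (`|y| ^+ 2); apply: (@cvg_series_pairs K K).
  under [X in series X]eq_fun do
    rewrite shifted_even shifted_odd linearNr linearDr/= yh0 oppr0 normr0 expr0n addr0 addr0.
  exact: parseval.
under eq_fun do rewrite shifted_even linearDr/= yh0 addr0.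
exact: coef2_cvg0.
Qed.

(** The odd-indexed terms are - <y, h> e_n; they tend to 0, but have norm
    |<y, h>| for the infinitely many unit vectors e_n. *)
Lemma dual_cvg_orth y :
  series (fun i => dot y (shifted i) *: doubled i) @ \oo --> y -> dot y h = 0.
Proof.
move=> cy; have : cvgn (series (fun i => dot y (shifted i) *: doubled i)).
  by apply/cvg_ex; exists y.
move=> /cvg_series_cvg_0/cvgr0Pnorm_lt lt_eps; apply/eqP/negPn/negP => c0.
have /lt_eps[N _ tail] : 0 < `|dot y h| by rewrite normr_gt0.
have [n Nn en1] := unit_infinitely_often N.
have := tail n.*2.+1; rewrite /= shifted_odd doubled_odd linearNr/= normrZ normrN.
rewrite en1 mulr1 ltxx => /(_ _)/notF; apply.
by rewrite (leq_trans Nn)// ltnW// ltnS -addnn leq_addr.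
Qed.

End Counterexample.

(** * The scalar fields *)

Lemma norm_scalar_conj (R : realType) (s : scalars) (a : scalar_field R s) :
  `|scalar_conj a| = `|a|.
Proof. by case: s a => a //=; exact: normcJ. Qed.

Lemma mul_scalar_conj (R : realType) (s : scalars) (a : scalar_field R s) :
  a * scalar_conj a = `|a| ^+ 2.
Proof.
case: s a => a /=; first by rewrite real_normK ?num_real// expr2.
by rewrite sqr_normc.
Qed.

Theorem corollary5p2 (R : realType) (s : scalars)
    (H : completeNormedModType (scalar_field R s))
    (dot : {dot H for @scalar_conj R s})
    (Hnorm : induces_norm dot)
    (Hdim : infinite_dimensional H)
    (Hsep : separable H) :
  (forall g f : nat -> H,
      bessel_sequence dot g ->
      (forall x : H, series (fun i => dot x (g i) *: f i) @ \oo --> x) ->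
      forall y : H, square_summable (fun i => dot y (f i)) ->
        series (fun i => dot y (f i) *: g i) @ \oo --> y)
  /\
  (exists g f : nat -> H,
      [/\ bessel_sequence dot g,
          forall x : H, series (fun i => dot x (g i) *: f i) @ \oo --> x,
          l2_domain dot f <> setT
        & forall y : H,
            series (fun i => dot y (f i) *: g i) @ \oo --> y
            <-> y \in l2_domain dot f]).
Proof.
have cn := @norm_scalar_conj R s; have mc := @mul_scalar_conj R s.
split; first exact: (dual_reconstruction cn mc Hnorm).
have [e [expansion parseval unit_io]] := parseval_frame_exists cn mc Hnorm Hdim Hsep.
have [k _ ek1] := unit_io 0%N.
have bessel := doubled_bessel parseval.
have rec := shifted_reconstruction (e k) expansion parseval.
have domainP := shifted_l2_domainP (e k) parseval.
exists (doubled e), (shifted e (e k)); split => // [domT|y].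
  have /domainP/eqP : l2_domain dot (shifted e (e k)) (e k) by rewrite domT.
  by rewrite -Hnorm ek1 expr1n oner_eq0.
rewrite in_setE; split => [|sq]; first by move=> /(dual_cvg_orth unit_io)/domainP.
exact: (dual_reconstruction cn mc Hnorm).
Qed.
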